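(* Let $x,y>1$ be fixed. Let $G=(V,E)$ be a finite simple graph with $|V|=n$ and tree-width $\mathrm{tw}(G)$. For the single site flip chain on $G$ associated with the weights $$w(G[S])=(x-1)^{\mathrm{rk}_2(S)}(y-1)^{|S|-\mathrm{rk}_2(S)},\qquad S\subseteq V,$$ of the bivariate interlace polynomial $q(G;x,y)=\sum_{S\subseteq V}(x-1)^{\mathrm{rk}_2(S)}(y-1)^{|S|-\mathrm{rk}_2(S)}$, the mixing time satisfies $$\tau(\varepsilon)=O\left(n^{2+8(\mathrm{tw}(G)+1)|\log_2((x-1)/(y-1))|}\,\log(1/\varepsilon)\right).$$
   Context: All graphs are finite and simple. For $S\subseteq V$, $G[S]$ is the subgraph of $G$ induced by $S$ and $\mathrm{rk}_2(S)$ is the rank over $\mathbb{F}_2$ of the adjacency matrix of $G[S]$. Single site flip chain on $G=(V,E)$ with positive weights $w(G[S])$: the state space is $\Omega'=2^V$. From $X_t\subseteq V$, pick $v\in V$ uniformly at random, let $S=X_t\oplus\{v\}$ ($\oplus$ is symmetric difference), and set $X_{t+1}=S$ with probability $\frac12\min\{1,w(G[S])/w(G[X_t])\}$ and $X_{t+1}=X_t$ otherwise. Its unique stationary distribution $\pi'$ satisfies $\pi'(S)\propto w(G[S])$. Mixing time. $\|\nu-\nu'\|_{TV}=\frac12\sum_{H\in\Omega'}|\nu(H)-\nu'(H)|$, and with $P'$ the transition matrix, $\tau(\varepsilon)=\max_{H\in\Omega'}\min\{t: \|P'^t(H,\cdot)-\pi'\|_{TV}\le\varepsilon\}$. In the bound,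 $0<\varepsilon\le1/2$, and the implied constant may depend on $x$, $y$ and $\mathrm{tw}(G)$, but not otherwise on $G$ and not on $\varepsilon$. *)

(* Defs.v *)
From HB Require Import structures.
From mathcomp Require Import all_boot all_order all_algebra.
From mathcomp Require Import boolp classical_sets reals constructive_ereal ereal exp.
From mathcomp Require Import ring lra.

Set Implicit Arguments.
Unset Strict Implicit.
Unset Printing Implicit Defensive.

Import Order.TTheory GRing.Theory Num.Theory.

Local Open Scope ring_scope.

(** A finite simple graph is a symmetric irreflexive [e : rel T] on a finType. *)

Section Treewidth.

(* Connected, nonempty, and without simple cycles of length at least 3. *)
Definition is_tree (I : finType) (t : rel I) : Prop :=
  [/\ symmetric t, irreflexive t, (0 < #|I|)%N,
      (forall i j : I, connect t i j)
    & (forall p : seq I, ucycle t p -> (size p < 3)%N)].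

Definition tree_decomposition (T I : finType) (e : rel T) (t : rel I)
    (bag : I -> {set T}) : Prop :=
  [/\ is_tree t,
      (forall v : T, exists i : I, v \in bag i),
      (forall u v : T, e u v -> exists i : I, (u \in bag i) && (v \in bag i))
    & (forall (v : T) (i j : I), v \in bag i -> v \in bag j ->
         connect [rel a b | [&& t a b, v \in bag a & v \in bag b]] i j)].

(* Truncated predecessor: only matters on the empty graph, which gets width 0
   instead of -1. *)
Definition decomposition_width (T I : finType) (bag : I -> {set T}) : nat :=
  (\max_(i : I) #|bag i|).-1.

Definition has_decomposition_of_width (T : finType) (e : rel T) (k : nat) : Prop :=
  exists (I : finType) (t : rel I) (bag : I -> {set T}),
    tree_decomposition e t bag /\ decomposition_width bag = k.

Lemma has_decomposition_ex (T : finType) (e : rel T) :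
  exists k : nat, `[< has_decomposition_of_width e k >].
Proof.
exists #|T|.-1; apply/asboolP.
exists unit, (fun _ _ => false), (fun=> [set: T]%SET); split; last first.
  by rewrite /decomposition_width (big_pred1 tt) ?cardsT//; move=> [].
split; [|by move=> v; exists tt; rewrite finset.in_setT| |].
- split=> //; first by rewrite card_unit.
  + by move=> [] []; exact: connect0.
  + by case=> [|a [|b p]] // [].
- by move=> u v _; exists tt; rewrite !finset.inE.
- by move=> v [] [] _ _; exact: connect0.
Qed.

Definition treewidth (T : finType) (e : rel T) : nat :=
  ex_minn (has_decomposition_ex e).

End Treewidth.

Section Weights.

Definition induced_adjacency (T : finType) (e : rel T) (S : {set T}) : 'M['F_2]_#|S| :=
  \matrix_(i, j) (e (enum_val i) (enum_val j))%:R.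

Definition rk2 (T : finType) (e : rel T) (S : {set T}) : nat :=
  \rank (induced_adjacency e S).

Definition interlace_weight (R : realType) (T : finType) (e : rel T) (x y : R)
    (S : {set T}) : R :=
  (x - 1) ^+ rk2 e S * (y - 1) ^+ (#|S| - rk2 e S).

End Weights.

Section FiniteMarkovChains.

Definition tv_dist (R : realType) (A : finType) (nu nu' : A -> R) : R :=
  2^-1 * \sum_(a : A) `|nu a - nu' a|.

(* The matrix is indexed by the canonical enumeration of [A]. *)
Definition transition_matrix (R : realType) (A : finType) (P : A -> A -> R) :
    'M[R]_#|A| :=
  \matrix_(i, j) P (enum_val i) (enum_val j).

Definition tstep (R : realType) (A : finType) (P : A -> A -> R) (t : nat) (a b : A) : R :=
  (transition_matrix P ^+ t) (enum_rank a) (enum_rank b).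

(* The infimum of a set of naturals is its minimum when the set is nonempty,
   and +oo when the chain never gets within [eps]. *)
Definition mixing_time (R : realType) (A : finType) (P : A -> A -> R) (pi : A -> R)
    (eps : R) : \bar R :=
  \big[Order.max/-oo%E]_(a : A)
    ereal_inf [set (t%:R : R)%:E | t in [set t : nat | tv_dist (tstep P t a) pi <= eps]]%classic.

Definition stationary_distribution (R : realType) (A : finType) (P : A -> A -> R)
    (pi : A -> R) : Prop :=
  [/\ forall a : A, 0 <= pi a, \sum_(a : A) pi a = 1
    & forall b : A, \sum_(a : A) pi a * P a b = pi b].

End FiniteMarkovChains.

Section FlipChain.

Definition symdiff (T : finType) (A B : {set T}) : {set T} := (A :\: B) :|: (B :\: A).

Definition flip_accept (R : realType) (T : finType) (w : {set T} -> R)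
    (X S : {set T}) : R :=
  2^-1 * Order.min 1 (w S / w X).

Definition flip_chain (R : realType) (T : finType) (w : {set T} -> R)
    (X Y : {set T}) : R :=
  \sum_(v : T) #|T|%:R^-1 *
    (let S := symdiff X [set v]%SET in
     flip_accept w X S * (Y == S)%:R + (1 - flip_accept w X S) * (Y == X)%:R).

Definition gibbs (R : realType) (T : finType) (w : {set T} -> R) (S : {set T}) : R :=
  w S / \sum_(S' : {set T}) w S'.

End FlipChain.

(** [gibbs w] is the unique stationary distribution of [flip_chain w]. *)
Section Stationarity.

Variables (R : realType) (T : finType) (w : {set T} -> R).
Hypothesis w_gt0 : forall S, 0 < w S.

Lemma symdiffK (X : {set T}) (B : {set T}) : symdiff (symdiff X B) B = X.
Proof. by apply/finset.setP => u; rewrite !finset.inE; do 2!case: (u \in _). Qed.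

Lemma symdiff_eq (X Y B : {set T}) : (Y == symdiff X B) = (X == symdiff Y B).
Proof. by apply/eqP/eqP => ->; rewrite symdiffK. Qed.

Lemma accept_balance (X S : {set T}) :
  w X * flip_accept w X S = w S * flip_accept w S X.
Proof.
have aE A B : w A * Order.min 1 (w B / w A) = Order.min (w A) (w B).
  by rewrite minr_pMr ?(ltW (w_gt0 _))// mulr1 mulrC divfK ?gt_eqF.
by rewrite /flip_accept [LHS]mulrCA [RHS]mulrCA !aE minC.
Qed.

Lemma flip_balance (X Y : {set T}) :
  w X * flip_chain w X Y = w Y * flip_chain w Y X.
Proof.
rewrite /flip_chain !mulr_sumr; apply: eq_bigr => v _ /=.
rewrite [LHS]mulrCA [RHS]mulrCA; congr (_ * _); rewrite !mulrDr; congr (_ + _).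
  rewrite [LHS]mulrA [RHS]mulrA (symdiff_eq X Y).
  case: (X =P symdiff Y [set v]%SET) => [XY|]; last by rewrite !mulr0.
  have -> : symdiff X [set v]%SET = Y by rewrite XY symdiffK.
  by rewrite /= !mulr1 -XY accept_balance.
by rewrite (eq_sym X); case: eqP => [->|]; rewrite ?mulr0.
Qed.

Lemma flip_chain_sum1 (T_gt0 : (0 < #|T|)%N) (X : {set T}) :
  \sum_Y flip_chain w X Y = 1.
Proof.
rewrite exchange_big /= (eq_bigr (fun=> #|T|%:R^-1)) => [|v _].
  by rewrite sumr_const -[LHS]mulr_natr mulVf// pnatr_eq0 -lt0n.
have sum1 (Z : {set T}) : \sum_(Y : {set T}) (Y == Z)%:R = 1 :> R.
  rewrite (bigD1 Z)//= eqxx big1 ?addr0// => Y /negPf -> //.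
by rewrite -mulr_sumr big_split /= -!mulr_sumr !sum1; ring.
Qed.

Lemma flip_accept_gt0 (X S : {set T}) : 0 < flip_accept w X S.
Proof. by rewrite /flip_accept mulr_gt0// lt_min ltr01 divr_gt0. Qed.

Lemma flip_accept_le1 (X S : {set T}) : flip_accept w X S <= 1.
Proof.
have : Order.min 1 (w S / w X) <= 1 by rewrite ge_min lexx.
by rewrite /flip_accept; lra.
Qed.

Lemma flip_chain_ge0 (X Y : {set T}) : 0 <= flip_chain w X Y.
Proof.
apply: sumr_ge0 => v _; rewrite mulr_ge0// addr_ge0// mulr_ge0//.
  exact/ltW/flip_accept_gt0.
by rewrite subr_ge0 flip_accept_le1.
Qed.

Lemma flip_chain_flip_gt0 (X : {set T}) (v : T) :
  0 < flip_chain w X (symdiff X [set v]%SET).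
Proof.
rewrite /flip_chain (bigD1 v)//= ltr_pwDl//.
  have T0 : (0 < #|T|)%N by apply/card_gt0P; exists v.
  rewrite mulr_gt0 ?invr_gt0 ?ltr0n// eqxx mulr1 ltr_pwDl ?flip_accept_gt0//.
  by rewrite mulr_ge0// subr_ge0 flip_accept_le1.
apply: sumr_ge0 => u _; rewrite mulr_ge0// addr_ge0// mulr_ge0//.
  exact/ltW/flip_accept_gt0.
by rewrite subr_ge0 flip_accept_le1.
Qed.

Lemma partition_gt0 : 0 < \sum_(S : {set T}) w S.
Proof.
rewrite (bigD1 finset.set0)//= ltr_pwDl//.
by apply: sumr_ge0 => S _; exact: ltW.
Qed.

Lemma flip_connected (Q : {set T} -> Prop) (X : {set T}) :
  Q X -> (forall Y v, Q Y -> Q (symdiff Y [set v]%SET)) -> forall Y, Q Y.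
Proof.
move=> QX Qs Y.
have [n] := ubnP #|symdiff X Y|; elim: n X QX => // n IH X QX ltn.
have [D0|[v vD]] := finset.set_0Vmem (symdiff X Y).
  suff -> : Y = X by [].
  apply/finset.setP => u; have := finset.in_set0 u; rewrite -D0 !finset.inE.
  by do 2!case: (u \in _).
apply: IH (Qs X v QX) _; rewrite -ltnS; apply: leq_trans ltn; rewrite ltnS.
apply: proper_card; apply/fintype.properP; split.
  apply/fintype.subsetP => u; move: vD; rewrite !finset.inE; have [->|_] := eqVneq u v.
    by do 2!case: (v \in _).
  by do 2!case: (u \in _).
exists v => //; move: vD; rewrite !finset.inE eqxx.
by do 2!case: (v \in _).
Qed.

Lemma gibbs_stationaryP (T_gt0 : (0 < #|T|)%N) (pi : {set T} -> R) :
  stationary_distribution (flip_chain w) pi <-> pi = gibbs w.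
Proof.
have Z0 := partition_gt0; split => [[_ pi1 piP]|->]; last first.
  split=> [S||Y]; first by rewrite divr_ge0 ?ltW.
    by rewrite -mulr_suml divff ?gt_eqF.
  under eq_bigr do rewrite /gibbs mulrAC flip_balance mulrAC.
  by rewrite -mulr_sumr flip_chain_sum1// mulr1.
pose h X := pi X / w X.
have hP Y : \sum_X flip_chain w Y X * h X = h Y.
  rewrite /h -piP mulr_suml; apply: eq_bigr => X _.
  have := flip_balance X Y.
  have := w_gt0 X; have := w_gt0 Y => wY wX E.
  apply: (mulfI (lt0r_neq0 wY)); rewrite !mulrA -E.
  by field; rewrite !gt_eqF.
pose M := [arg max_(X > finset.set0) h X]%O.
have hM X : h X <= h M by rewrite /M; case: arg_maxP => // i _; apply.
have hE : forall Y, h Y = h M.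
  apply: (@flip_connected (fun Y => h Y = h M) M) => // Y v hY.
  apply/eqP; rewrite -subr_eq0 -oppr_eq0 opprB; apply/eqP.
  have S0 : \sum_X flip_chain w Y X * (h M - h X) = 0.
    under eq_bigr do rewrite mulrBr.
    by rewrite sumrB hP -mulr_suml flip_chain_sum1// mul1r hY subrr.
  have ge0 X : true -> 0 <= flip_chain w Y X * (h M - h X).
    by move=> _; rewrite mulr_ge0 ?flip_chain_ge0// subr_ge0.
  set Y' := symdiff Y _.
  have /eqP : flip_chain w Y Y' * (h M - h Y') = 0 by exact: (psumr_eq0P ge0 S0).
  by rewrite mulf_eq0 gt_eqF ?flip_chain_flip_gt0//= => /eqP.
have piE X : pi X = h M * w X by rewrite -(hE X) divfK ?gt_eqF.
apply/funext => X; rewrite /gibbs piE mulrC; congr (_ * _).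
apply: (mulIf (lt0r_neq0 Z0)); rewrite mulVf ?gt_eqF// -pi1 mulr_sumr.
by apply: eq_bigr => Y _; rewrite piE.
Qed.

End Stationarity.

(* Main.v *)
Require Import Defs.
From HB Require Import structures.
From mathcomp Require Import all_boot all_order all_algebra.
From mathcomp Require Import boolp classical_sets reals constructive_ereal ereal exp.
From mathcomp Require Import sequences ring lra zify.

Import Order.TTheory GRing.Theory Num.Theory.

Import boot.fintype boot.finset.

Local Open Scope ring_scope.

(** The proof bounds the spectral gap of the flip chain by a Poincare inequality.  Write
    [w(S) = (y-1)^|S| rho^rk(S)] with [rho = (x-1)/(y-1)], and [theta = max(rho, 1/rho)].
    Deleting a vertex changes the rank by at most 2, so replacing [w] by the product of its
    restriction to [U \ v] and a weight on the single site [v] costs a factor [theta^2] in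
    either direction, hence [theta^4] in the Poincare constant (Holley-Stroock).  After
    deleting a balanced separator of at most [tw + 1] vertices the weight is an exact product
    over parts with at most half of the vertices, and Poincare constants tensorize; since the
    recursion has depth [log2 n], the constant is [O(n^(4 (tw+1) |log2 rho|))].  Laziness then
    gives [L^2] contraction at rate [1 - 1/(4 n K)], and [log (1/pi_min) = O(n)] yields
    mixing in [O(n^2 K log(1/eps))] steps. *)

(** * The binary rank under vertex deletion and disjoint union *)

Section Rank.
Variables (T : finType) (e : rel T).

(** Rows and columns outside [S] are zeroed rather than removed, so that the matrices of different
    sets have one size and can be added. *)
Definition padded_adjacency (S : {set T}) : 'M['F_2]_#|T| :=
  \matrix_(i, j) [&& e (enum_val i) (enum_val j), enum_val i \in S & enum_val j \in S]%:R.

(** The inclusion matrix [E] satisfies [E^T *m E = 1%:M], so each of the two matrices arises from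
    the other by multiplication on both sides. *)
Lemma rk2_padded (S : {set T}) : rk2 e S = \rank (padded_adjacency S).
Proof.
pose E : 'M['F_2]_(#|T|, #|S|) := \matrix_(i, j) (enum_val i == enum_val j)%:R.
have EK : E^T *m E = 1%:M.
  apply/matrixP => i j; rewrite !mxE (bigD1 (enum_rank (enum_val i)))//= big1 => [|l li].
    by rewrite !mxE enum_rankK eqxx mul1r addr0 (inj_eq enum_val_inj).
  rewrite !mxE (_ : (enum_val l == enum_val i) = false) ?mul0r//.
  by apply/negbTE; apply: contra_neq li => <-; rewrite enum_valK.
have -> : padded_adjacency S = E *m induced_adjacency e S *m E^T.
  apply/matrixP => i j; rewrite !mxE.
  have [jS|jS] := boolP (enum_val j \in S); last first.
    rewrite !andbF big1// => l _; rewrite !mxE (_ : (enum_val j == _) = false) ?mulr0//.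
    by apply/negbTE; apply: contraNneq jS => ->; apply: enum_valP.
  rewrite (bigD1 (enum_rank_in jS (enum_val j)))//= [X in _ + X]big1 => [|l lj]; last first.
    rewrite [X in _ * X]mxE [X in _ * X]mxE (_ : (enum_val j == _) = false) ?mulr0//.
    by apply/negbTE; apply: contra_neq lj => ejl; apply: enum_val_inj; rewrite enum_rankK_in.
  rewrite addr0 [X in _ * X]mxE [X in _ * X]mxE enum_rankK_in// eqxx mulr1 andbT mxE.
  have [iS|iS] := boolP (enum_val i \in S); last first.
    rewrite !andbF big1// => l _; rewrite !mxE (_ : (enum_val i == _) = false) ?mul0r//.
    by apply/negbTE; apply: contraNneq iS => ->; apply: enum_valP.
  rewrite (bigD1 (enum_rank_in iS (enum_val i)))//= [X in _ + X]big1 => [|l li]; last first.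
    rewrite [X in X * _]mxE (_ : (enum_val i == _) = false) ?mul0r//.
    by apply/negbTE; apply: contra_neq li => eil; apply: enum_val_inj; rewrite enum_rankK_in.
  by rewrite addr0 !mxE !enum_rankK_in// eqxx mul1r andbT.
rewrite /rk2; apply/eqP; rewrite eqn_leq; apply/andP; split; last first.
  exact: leq_trans (mxrankM_maxl _ _) (mxrankM_maxr _ _).
have {1}-> : induced_adjacency e S = E^T *m (E *m induced_adjacency e S *m E^T) *m E.
  by rewrite !mulmxA EK mul1mx -mulmxA EK mulmx1.
exact: leq_trans (mxrankM_maxl _ _) (mxrankM_maxr _ _).
Qed.

Definition coord_proj (S : {set T}) : 'M['F_2]_#|T| :=
  diag_mx (\row_i (enum_val i \in S)%:R).

Lemma coord_proj_padded (A S : {set T}) :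
  coord_proj A *m padded_adjacency S *m coord_proj A = padded_adjacency (A :&: S).
Proof.
apply/matrixP => i j; rewrite mul_mx_diag mxE mul_diag_mx !mxE !inE.
by do 5![case: (_ \in _) || case: (e _ _)]; rewrite ?mul0r ?mulr0 ?mulr1.
Qed.

Lemma rk2_le_card (S : {set T}) : (rk2 e S <= #|S|)%N.
Proof. exact: rank_leq_row. Qed.

Lemma rk2_subset (A S : {set T}) : A \subset S -> (rk2 e A <= rk2 e S)%N.
Proof.
move=> /setIidPl AS; rewrite !rk2_padded -{1}AS -coord_proj_padded.
exact: leq_trans (mxrankM_maxl _ _) (mxrankM_maxr _ _).
Qed.

(** The entries lost with [v] are those of its row and its column, and each of these contributes a
    matrix of rank at most 1. *)
Lemma rk2_setD1 (S : {set T}) (v : T) : (rk2 e S <= rk2 e (S :\ v) + 2)%N.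
Proof.
rewrite !rk2_padded.
pose c : 'cV['F_2]_#|T| := \col_i (enum_val i == v)%:R.
pose r1 : 'rV['F_2]_#|T| := \row_j [&& e v (enum_val j), v \in S & enum_val j \in S]%:R.
pose c2 : 'cV['F_2]_#|T| :=
  \col_i [&& e (enum_val i) v, enum_val i \in S, v \in S & enum_val i != v]%:R.
have -> : padded_adjacency S = padded_adjacency (S :\ v) + (c *m r1 + c2 *m c^T).
  apply/matrixP => i j; rewrite !mxE !big_ord1 !mxE !inE.
  have [->|ni] := eqVneq (enum_val i) v.
    by rewrite /= !andbF mul0r add0r addr0 mul1r.
  have [->|nj] := eqVneq (enum_val j) v.
    by rewrite /= !andbF andbT mul0r !add0r mulr1.
  by rewrite /= mul0r mulr0 !addr0.
have le1 m n (a : 'cV['F_2]_m) (b : 'rV['F_2]_n) : (\rank (a *m b) <= 1)%N.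
  exact: leq_trans (mxrankM_maxl _ _) (rank_leq_col _).
apply: leq_trans (mxrank_add _ _) _; rewrite leq_add2l.
exact: leq_trans (mxrank_add _ _) (leq_add (le1 _ _ _ _) (le1 _ _ _ _)).
Qed.

(** The matrix of the union is block diagonal, and the row spaces of the two blocks are supported on
    disjoint sets of columns. *)
Lemma rk2_setU (A B : {set T}) : [disjoint A & B] ->
    (forall u v, u \in A -> v \in B -> ~~ e u v && ~~ e v u) ->
  rk2 e (A :|: B) = (rk2 e A + rk2 e B)%N.
Proof.
move=> dAB eAB; rewrite !rk2_padded.
set M := padded_adjacency (A :|: B); set MA := padded_adjacency A.
set MB := padded_adjacency B.
have ME : M = MA + MB.
  apply/matrixP => i j; rewrite !mxE !inE.
  have [iA|iA] := boolP (enum_val i \in A); have [jA|jA] := boolP (enum_val j \in A).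
  - by rewrite (disjointFr dAB iA) andbF addr0.
  - rewrite (disjointFr dAB iA) /= !andbF !addr0.
    by have [/(eAB _ _ iA)/andP[/negPf->]//|] := boolP (enum_val j \in B); rewrite ?andbF.
  - rewrite (disjointFr dAB jA) /= !andbF !addr0 andbT.
    by have [/(eAB _ _ jA)/andP[_ /negPf->]//|] := boolP (enum_val i \in B); rewrite ?andbF.
  - by rewrite !andbF add0r.
have MA1 : coord_proj A *m M = MA.
  apply/matrixP => i j; rewrite ME mul_diag_mx !mxE.
  have [iA|iA] := boolP (enum_val i \in A); last by rewrite andbF mul0r.
  by rewrite (disjointFr dAB iA) andbF addr0 mul1r.
have MB1 : coord_proj B *m M = MB.
  apply/matrixP => i j; rewrite ME mul_diag_mx !mxE.
  have [iA|iA] := boolP (enum_val i \in B); last by rewrite andbF mul0r.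
  by rewrite (disjointFl dAB iA) andbF add0r mul1r.
have MAA : MA *m coord_proj A = MA.
  apply/matrixP => i j; rewrite mul_mx_diag !mxE.
  by case: (enum_val j \in A); rewrite ?andbF ?mulr1 ?mulr0.
have MBA : MB *m coord_proj A = 0.
  apply/matrixP => i j; rewrite mul_mx_diag !mxE.
  have [jA|jA] := boolP (enum_val j \in A); last by rewrite mulr0.
  by rewrite (disjointFr dAB jA) !andbF mul0r.
(* The projection onto [A] fixes the row space of [MA] and kills that of [MB]. *)
have MAB : (MA :&: MB = 0)%MS.
  apply/eqP; rewrite -submx0; set X := (_ :&: _)%MS.
  have /submxP[D1 XA] : (X <= MA)%MS by apply: capmxSl.
  have /submxP[D2 XB] : (X <= MB)%MS by apply: capmxSr.
  have -> : X = X *m coord_proj A by rewrite {2}XA -mulmxA MAA.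
  by rewrite XB -mulmxA MBA mulmx0.
rewrite -(mxrank_disjoint_sum MAB); apply/eqmx_rank/andP; split.
  rewrite ME; exact: addmx_sub_adds.
by rewrite addsmx_sub -{1}MA1 -{1}MB1 !submxMl.
Qed.
End Rank.

(** * Poincare inequalities on the subsets of a finite set *)

Section Poincare.
Variables (R : realType) (T : finType).
Implicit Types (U S : {set T}) (w f : {set T} -> R) (K : R).

Local Notation flip S v := (symdiff S [set v]%SET).

(* The unnormalised Dirichlet form of the Metropolis chain on the subsets of [U]. *)
Definition dirichlet U w f : R :=
  \sum_(S : {set T} | S \subset U) \sum_(v in U)
     Order.min (w S) (w (flip S v)) * (f (flip S v) - f S) ^+ 2.

(* The existential constant plays the role of the mean of [f]. *)
Definition poincare U w K : Prop :=
  forall f, exists c : R,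
    \sum_(S : {set T} | S \subset U) w S * (f S - c) ^+ 2 <= K * dirichlet U w f.

Lemma flip_subset U S v : v \in U -> S \subset U -> flip S v \subset U.
Proof.
move=> vU /subsetP SU; apply/subsetP => u; rewrite !inE.
by case/orP => /andP[]; [move=> _ /SU|move=> _ /eqP->].
Qed.

Lemma dirichlet_ge0 U w f : (forall S, 0 < w S) -> 0 <= dirichlet U w f.
Proof.
move=> w0; apply: sumr_ge0 => S _; apply: sumr_ge0 => v _.
by rewrite mulr_ge0 ?sqr_ge0// le_min !ltW.
Qed.

Lemma poincare_le {U w K} K' : (forall S, 0 < w S) -> K <= K' ->
  poincare U w K -> poincare U w K'.
Proof.
move=> w0 KK' pU f; have [c cP] := pU f; exists c; apply: le_trans cP _.
by rewrite ler_wpM2r// dirichlet_ge0.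
Qed.

(* Both sides of a Poincare inequality are monotone in the weight (the left one because
   it is a minimum over constants), whence the Holley-Stroock perturbation principle. *)
Lemma poincare_perturb U w w' B K : 0 <= K -> 0 <= B ->
    (forall S, S \subset U -> w S <= B * w' S) ->
    (forall S, S \subset U -> w' S <= B * w S) ->
  poincare U w' K -> poincare U w (B ^+ 2 * K).
Proof.
move=> K0 B0 ww' w'w pU f; have [c cP] := pU f; exists c.
have le1 : \sum_(S : {set T} | S \subset U) w S * (f S - c) ^+ 2
    <= B * \sum_(S : {set T} | S \subset U) w' S * (f S - c) ^+ 2.
  rewrite mulr_sumr; apply: ler_sum => S SU.
  by rewrite [B * _]mulrA ler_wpM2r ?sqr_ge0// ww'.
have le2 : dirichlet U w' f <= B * dirichlet U w f.
  rewrite /dirichlet mulr_sumr; apply: ler_sum => S SU.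
  rewrite mulr_sumr; apply: ler_sum => v vU.
  rewrite [B * _]mulrA ler_wpM2r ?sqr_ge0// minr_pMr//.
  by rewrite le_min !ge_min w'w//= w'w ?orbT// flip_subset.
apply: le_trans le1 _; rewrite expr2 -!mulrA ler_wpM2l//.
by apply: le_trans cP _; rewrite mulrCA ler_wpM2l.
Qed.

(** The cross term vanishes because [m] is the mean for the weights [p]; these are not normalised,
    hence the factor [Z]. *)
Lemma sum_sqr_mean (I : finType) (P : pred I) (p g : I -> R) (c : R) :
    let Z := \sum_(i | P i) p i in let m := (\sum_(i | P i) p i * g i) / Z in Z != 0 ->
  \sum_(i | P i) p i * (g i - c) ^+ 2 =
  \sum_(i | P i) p i * (g i - m) ^+ 2 + Z * (m - c) ^+ 2.
Proof.
move=> Z m Z0.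
have mE : \sum_(i | P i) p i * g i = Z * m by rewrite mulrC divfK.
have expand d : \sum_(i | P i) p i * (g i - d) ^+ 2 =
    \sum_(i | P i) p i * g i ^+ 2 - 2 * d * (Z * m) + Z * d ^+ 2.
  rewrite -mE mulr_sumr mulr_suml -sumrB -big_split /=.
  by apply: eq_bigr => i _; ring.
by rewrite !expand; ring.
Qed.

Lemma sum_sqr_mean_le (I : finType) (P : pred I) (p g : I -> R) (c : R) :
    let Z := \sum_(i | P i) p i in let m := (\sum_(i | P i) p i * g i) / Z in 0 < Z ->
  \sum_(i | P i) p i * (g i - m) ^+ 2 <= \sum_(i | P i) p i * (g i - c) ^+ 2.
Proof.
move=> Z m Z0; rewrite [leRHS]sum_sqr_mean ?gt_eqF// lerDl.
by rewrite mulr_ge0 ?sqr_ge0// ltW.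
Qed.

(** This is the decomposition about the mean at [c = 0], with the nonnegative variance term
    dropped. *)
Lemma jensen_sqr (I : finType) (P : pred I) (p g : I -> R) :
    let Z := \sum_(i | P i) p i in let m := (\sum_(i | P i) p i * g i) / Z in
    (forall i, 0 <= p i) -> 0 < Z ->
  Z * m ^+ 2 <= \sum_(i | P i) p i * g i ^+ 2.
Proof.
move=> Z m p0 Z0.
have -> : \sum_(i | P i) p i * g i ^+ 2 = \sum_(i | P i) p i * (g i - 0) ^+ 2.
  by apply: eq_bigr => i _; rewrite subr0.
rewrite [leRHS]sum_sqr_mean ?gt_eqF// subr0 lerDr; apply: sumr_ge0 => i _.
by rewrite mulr_ge0 ?sqr_ge0.
Qed.

Lemma sum_subsetU (A B : {set T}) (F : {set T} -> R) : [disjoint A & B] ->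
  \sum_(S : {set T} | S \subset A :|: B) F S =
  \sum_(S : {set T} | S \subset A) \sum_(S' : {set T} | S' \subset B) F (S :|: S').
Proof.
move=> dAB; rewrite pair_big /=.
rewrite (reindex_onto (fun p : {set T} * {set T} => p.1 :|: p.2)
  (fun S => (S :&: A, S :&: B))) /= => [|S SU]; last first.
  by rewrite -setIUr; apply/setIidPl.
apply: eq_bigl => -[S S'] /=; apply/andP/andP => [[_ /eqP[<- <-]]|[SA SB]].
  by rewrite !subsetIr.
split; first exact: setUSS.
have S'A : S' :&: A = set0.
  by apply/disjoint_setI0; rewrite disjoint_sym; apply: disjointWr SB dAB.
have SB0 : S :&: B = set0.
  by apply/disjoint_setI0; apply: disjointWl SA dAB.
rewrite !setIUl S'A SB0 setU0 set0U.
by rewrite (setIidPl SA) (setIidPl SB).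
Qed.

Lemma flip_setUl S S' v : v \notin S' -> flip (S :|: S') v = flip S v :|: S'.
Proof.
move=> vS'; apply/setP => u; rewrite !inE.
have [->|_] := eqVneq u v; first by rewrite (negPf vS') !orbF andbT.
by rewrite /= !andbF !orbF.
Qed.

Lemma flip_setUr S S' v : v \notin S -> flip (S :|: S') v = S :|: flip S' v.
Proof. by move=> vS; rewrite setUC flip_setUl// setUC. Qed.

(** Tensorization: the variance splits into the variance in the [A] part for a fixed [B] part,
    bounded by [pA], and the variance of the conditional mean [m], bounded by [pB]. The constant is
    not worsened. *)
Lemma poincare_setU (A B : {set T}) w w1 w2 K : [disjoint A & B] -> 0 <= K ->
    (forall S, 0 < w1 S) -> (forall S, 0 < w2 S) ->
    (forall S S', S \subset A -> S' \subset B -> w (S :|: S') = w1 S * w2 S') ->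
  poincare A w1 K -> poincare B w2 K -> poincare (A :|: B) w K.
Proof.
move=> dAB K0 w10 w20 wE pA pB f.
pose Z := \sum_(S : {set T} | S \subset A) w1 S.
have Z0 : 0 < Z.
  rewrite /Z (bigD1 set0) ?sub0set//= ltr_pwDl//.
  by apply: sumr_ge0 => S _; apply: ltW.
pose m S' := (\sum_(S : {set T} | S \subset A) w1 S * f (S :|: S')) / Z.
have [c cP] := pB m; exists c.
pose DA := \sum_(S' : {set T} | S' \subset B) w2 S' * dirichlet A w1 (fun S => f (S :|: S')).
pose DB := \sum_(S : {set T} | S \subset A) w1 S * dirichlet B w2 (fun S' => f (S :|: S')).
have vE v S : S \subset A -> v \in B -> v \notin S.
  by move=> /subsetP SA vB; apply/negP => /SA /(disjointFr dAB); rewrite vB.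
have vE' v S : S \subset B -> v \in A -> v \notin S.
  by move=> /subsetP SB vA; apply/negP => /SB /(disjointFl dAB); rewrite vA.
(* A flip at a site of [A] leaves the [B] part of the state alone, and conversely. *)
have DE : dirichlet (A :|: B) w f = DA + DB.
  rewrite /dirichlet sum_subsetU// /DA /DB.
  transitivity (\sum_(S : {set T} | S \subset A) \sum_(S' : {set T} | S' \subset B)
     (w2 S' * (\sum_(v in A) Order.min (w1 S) (w1 (flip S v)) *
                 (f (flip S v :|: S') - f (S :|: S')) ^+ 2)
     + w1 S * (\sum_(v in B) Order.min (w2 S') (w2 (flip S' v)) *
                 (f (S :|: flip S' v) - f (S :|: S')) ^+ 2))).
    apply: eq_bigr => S SA; apply: eq_bigr => S' S'B.
    rewrite (eq_bigl [predU A & B]) => [|v]; last by rewrite !inE.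
    rewrite bigU//=; congr (_ + _); rewrite mulr_sumr; apply: eq_bigr => v vU.
      rewrite flip_setUl ?vE'// !wE// ?flip_subset// [RHS]mulrA; congr (_ * _).
      by rewrite [RHS]minr_pMr ?(ltW (w20 _))// ![w2 S' * _]mulrC.
    rewrite flip_setUr ?vE// !wE// ?flip_subset// [RHS]mulrA; congr (_ * _).
    by rewrite [RHS]minr_pMr ?(ltW (w10 _)).
  under eq_bigr do rewrite big_split /=.
  rewrite big_split /=; congr (_ + _).
    by rewrite exchange_big /=; apply: eq_bigr => S' _; rewrite mulr_sumr.
  by apply: eq_bigr => S _; rewrite mulr_sumr.
have -> : \sum_(S : {set T} | S \subset A :|: B) w S * (f S - c) ^+ 2 =
    \sum_(S' : {set T} | S' \subset B) w2 S' *
        (\sum_(S : {set T} | S \subset A) w1 S * (f (S :|: S') - m S') ^+ 2)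
    + Z * \sum_(S' : {set T} | S' \subset B) w2 S' * (m S' - c) ^+ 2.
  rewrite sum_subsetU// exchange_big /= mulr_sumr -big_split /=.
  apply: eq_bigr => S' S'B; rewrite mulrCA -mulrDr -sum_sqr_mean ?gt_eqF// mulr_sumr.
  by apply: eq_bigr => S SA; rewrite wE// [w1 S * _]mulrC -mulrA.
rewrite DE mulrDr; apply: lerD.
  rewrite /DA mulr_sumr; apply: ler_sum => S' S'B.
  rewrite mulrCA ler_wpM2l ?(ltW (w20 _))//.
  have [d dP] := pA (fun S => f (S :|: S')).
  exact: le_trans (sum_sqr_mean_le _ _ _ _ d Z0) dP.
apply: (@le_trans _ _ (K * (Z * dirichlet B w2 m))).
  by rewrite mulrCA ler_wpM2l// ltW.
rewrite ler_wpM2l// /DB.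
under [leRHS]eq_bigr do rewrite mulr_sumr.
rewrite exchange_big /= /dirichlet mulr_sumr; apply: ler_sum => S' S'B.
under [leRHS]eq_bigr do rewrite mulr_sumr.
rewrite exchange_big /= mulr_sumr; apply: ler_sum => v vB.
rewrite mulrCA; under [leRHS]eq_bigr do rewrite mulrCA.
rewrite -mulr_sumr ler_wpM2l//; first by rewrite le_min !ltW.
(* The increment of [m] is the average of the increments of [f], so Jensen's inequality bounds its
   square. *)
have -> : m (flip S' v) - m S' =
   (\sum_(S : {set T} | S \subset A) w1 S * (f (S :|: flip S' v) - f (S :|: S'))) / Z.
  by rewrite /m -mulrBl -sumrB; under eq_bigr do rewrite -mulrBr.
by apply: jensen_sqr => // S; apply: ltW.
Qed.

Lemma sum_subset0 (F : {set T} -> R) : \sum_(S : {set T} | S \subset set0) F S = F set0.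
Proof. by apply: big_pred1 => S; rewrite /= subset0. Qed.

Lemma poincare_set0 w : poincare set0 w 1.
Proof.
move=> f; exists (f set0); rewrite /dirichlet !sum_subset0 subrr.
by rewrite expr0n mulr0 big_set0 mulr0.
Qed.

(** For two states of weights [p] and [q] the variance is [p * q / (p + q)] times the squared jump
    of [f]. This coefficient is below the smaller weight, and the Dirichlet form counts the jump
    once from each end. *)
Lemma poincare_set1 w v : (forall S, 0 < w S) -> poincare [set v]%SET w 1.
Proof.
move=> w0 f; set s := [set v]%SET; pose o := @set0 T.
have sumE (F : {set T} -> R) : \sum_(S : {set T} | S \subset s) F S = F o + F s.
  rewrite (bigD1 o) ?sub0set//=; congr (_ + _); apply: big_pred1 => S /=.
  rewrite subset1; have [->|_] := eqVneq S s; last exact: andbN.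
  by rewrite /= -card_gt0 cards1.
have -> : dirichlet s w f = 2 * (Order.min (w o) (w s) * (f s - f o) ^+ 2).
  have os : flip o v = s by apply/setP => u; rewrite !inE andbF.
  have so : flip s v = o by apply/setP => u; rewrite !inE andNb.
  by rewrite /dirichlet sumE !big_set1 os so minC -opprB sqrrN; ring.
exists ((w o * f o + w s * f s) / (w o + w s)).
rewrite sumE mul1r.
have := w0 o; have := w0 s; move: (w o) (w s) (f o) (f s) => p q fo fs q0 p0.
have -> : p * (fo - (p * fo + q * fs) / (p + q)) ^+ 2 +
   q * (fs - (p * fo + q * fs) / (p + q)) ^+ 2 = (p * q / (p + q)) * (fs - fo) ^+ 2.
  by field; rewrite gt_eqF// addr_gt0.
rewrite [leRHS]mulrA ler_wpM2r ?sqr_ge0// ler_pdivrMr ?addr_gt0//.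
have := mulr_gt0 p0 q0; have := mulr_gt0 p0 p0; have := mulr_gt0 q0 q0.
by have [_|_] := leP p q; nra.
Qed.

End Poincare.

Arguments dirichlet {R T}.
Arguments poincare {R T}.

(** * Balanced separators in a tree decomposition *)

Section BalancedSeparator.
Variables (I : finType) (t : rel I).
Hypothesis tree_t : is_tree t.

(** Only edges are dropped: [j] stays as an isolated node, so [connect (avoid j)] yields the
    components of the tree minus [j], and [j] alone. *)
Definition avoid (j : I) : rel I := fun a b => [&& t a b, a != j & b != j].

Lemma avoid_connect_sym j : connect_sym (avoid j).
Proof.
have [tS _ _ _ _] := tree_t; apply: sym_connect_sym => a b /=.
by rewrite /avoid tS [(_ != _) && _]andbC.
Qed.

(** Otherwise a walk through [c] joins [i] to [j] without their common edge; shortened to a simple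
    path and closed by that edge, it is a cycle of length at least 3. *)
Lemma tree_edge_bridge i j c : t i j ->
  connect (avoid i) j c -> connect (avoid j) i c -> False.
Proof.
have [tS tI _ _ tU] := tree_t => tij ijc jic.
pose r := [rel a b | [&& t a b, ~~ ((a == i) && (b == j)) & ~~ ((a == j) && (b == i))]].
have sub_r l : l \in [:: i; j] -> subrel (connect (avoid l)) (connect r).
  move=> lij; apply: connect_sub => a b /and3P[tab al bl]; apply: connect1.
  rewrite /= tab /=; move: lij al bl; rewrite !inE.
  by case/orP => /eqP-> /negPf-> /negPf->; rewrite ?andbF.
have rS : connect_sym r.
  by apply: sym_connect_sym => a b /=; rewrite tS; congr (_ && _); rewrite andbC
     [X in ~~ X && _]andbC [X in _ && ~~ X]andbC.
have : connect r i j.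
  apply: connect_trans (sub_r j _ _ _ jic) _; first by rewrite !inE eqxx orbT.
  by rewrite rS; apply: sub_r ijc; rewrite !inE eqxx.
case/connectP => p0 /shortenP[p rp up _] jE.
have tp : path t i p by apply: sub_path rp => a b /and3P[].
have : ucycle t (i :: p) by rewrite /ucycle up andbT /= rcons_path tp -jE tS.
(* The short cases remain: an empty path would make [t i i] hold, and a single step would be the
   edge removed in [r]. *)
move/tU; case: p rp jE {tp up} => [|l [|l' p]] //= rp jE _.
  by move: tij; rewrite jE tI.
by move: rp; rewrite jE !eqxx !andbF.
Qed.

(** A simple path from [i] to [a] never returns to [i] after its first step. *)
Lemma tree_first_step i a : a != i -> exists2 j, t i j & connect (avoid i) j a.
Proof.
have [_ _ _ tC _] := tree_t => ai.
have /connectP[p0 /shortenP[p tp up _] aE] := tC i a.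
case: p tp up aE => [|j p] /=; first by move=> _ _ /eqP; rewrite (negPf ai).
case/andP=> tij tp /andP[]; rewrite inE negb_or => /andP[ij ip] _ aE; exists j => //.
apply/connectP; exists p => //.
elim: p j tp ij ip {tij aE} => //= l p IH j /andP[tjl tp] ij.
rewrite inE negb_or => /andP[il ip].
by rewrite /avoid tjl [j == i]eq_sym ij [l == i]eq_sym il /=; apply: IH.
Qed.

Variables (T : finType) (e : rel T) (bag : I -> {set T}).
Hypothesis dec : tree_decomposition e t bag.
Variable U : {set T}.

Definition branch (j a : I) : {set T} :=
  [set v in U | (v \notin bag j) && [exists b, (v \in bag b) && connect (avoid j) a b]].

Lemma branch_connect j a b : connect (avoid j) a b -> branch j a = branch j b.
Proof.
move=> ab; apply/setP => v; rewrite !inE; do 2!congr (_ && _).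
by apply: eq_existsb => c; rewrite (same_connect (avoid_connect_sym j) ab).
Qed.

(** The nodes whose bags contain [v] span a connected part of the tree, and [j] is not among
    them. *)
Lemma bag_connect j v b b' : v \notin bag j -> v \in bag b -> v \in bag b' ->
  connect (avoid j) b b'.
Proof.
case: dec => _ _ _ cv vj vb vb'; apply: connect_sub (cv v b b' vb vb') => x y.
move=> /and3P[txy vx vy]; apply: connect1; rewrite /avoid txy /=.
by apply/andP; split; apply: contraNneq vj => <-.
Qed.

(** A bag of a common vertex would be reachable from both ends of the edge without crossing it. *)
Lemma branch_opposite i j : t i j -> [disjoint branch i j & branch j i].
Proof.
move=> tij; rewrite -setI_eq0; apply/eqP/setP => v; rewrite !inE; apply/negbTE/negP.
case/andP=> /and3P[_ vi /existsP[b /andP[vb ijb]]].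
case/and3P=> _ vj /existsP[b' /andP[vb' jib']].
apply: (tree_edge_bridge i j b' tij) => //.
exact: connect_trans ijb (bag_connect _ _ _ _ vi vb vb').
Qed.

(** Among the pairs whose branch holds more than half of [U], take one, [(i, a)], with the fewest
    tree nodes on the side of [a]. The neighbour [j] of [i] towards [a] is then the centroid. *)
Lemma centroid_bag : exists j, forall a, a != j -> ((#|branch j a|).*2 <= #|U|)%N.
Proof.
have [tS tI I0 tC _] := tree_t.
pose bad (p : I * I) := (p.2 != p.1) && (#|U| < (#|branch p.1 p.2|).*2)%N.
have [p0 badp0|nobad] := pickP bad; last first.
  have /card_gt0P[j _] := I0; exists j => a aj.
  by have := nobad (j, a); rewrite /bad /= aj /= ltnNge => /negbFE.
pose sz (p : I * I) := #|[set b | connect (avoid p.1) p.2 b]|.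
case: (arg_minnP sz badp0) => -[i a]; rewrite /bad /sz /= => /andP[ai bigD] minD.
have [j tij ja] := tree_first_step _ _ ai.
have ij : i != j by apply: contraTneq tij => ->; rewrite tI.
rewrite -(branch_connect _ _ _ ja) in bigD.
exists j => a' /tree_first_step[l tjl la'].
rewrite -(branch_connect _ _ _ la').
(* Back towards [i]: the two opposite branches are disjoint, so they cannot both exceed half of
   [U]. *)
have [->|li] := eqVneq l i.
  have := branch_opposite _ _ tij; rewrite -setI_eq0 => /eqP I0'.
  have : (#|branch i j :|: branch j i| <= #|U|)%N.
    by apply/subset_leq_card/subsetP => v; rewrite !inE => /orP[] /andP[].
  rewrite cardsU I0' cards0 subn0; move: bigD; rewrite -!addnn; lia.
have lj : l != j by apply: contraTneq tjl => ->; rewrite tI.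
rewrite leqNgt; apply/negP => bigl.
have := minD (j, l); rewrite /= lj bigl => /(_ isT); rewrite leqNgt => /negP; apply.
have iNl : ~~ connect (avoid j) l i.
  apply/negP => li'; apply: (tree_edge_bridge j l i tjl) => //.
  by apply: connect1; rewrite /avoid tS tij eq_sym lj eq_sym li.
have jia b : connect (avoid i) j b = connect (avoid i) a b.
  by rewrite (same_connect (avoid_connect_sym i) ja).
(* In any other direction the component of [l] off [j] lies inside that of [a] off [i] and misses
   [j], which contradicts minimality. *)
apply: proper_card; apply/properP; split; last first.
  exists j; first by rewrite inE -jia connect0.
  rewrite inE; apply/negP; rewrite avoid_connect_sym => /connectP[[|z p]] /=.
    by move=> _ /eqP; rewrite (negPf lj).
  by rewrite /avoid eqxx andbF.
apply/subsetP => b; rewrite !inE -jia => lb.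
apply: (@connect_trans _ _ l); first by apply: connect1; rewrite /avoid tjl eq_sym ij li.
case/connectP: lb => p; elim: p l li iNl {lj tjl la' bigl} => [|z p IH] l li iNl /=.
  by move=> _ ->; apply: connect0.
case/andP=> /and3P[tlz lj zj] pz bE.
have lz : connect (avoid j) l z by apply: connect1; rewrite /avoid tlz lj.
have zi : z != i by apply: contraNneq iNl => <-.
apply: (@connect_trans _ _ z); first by apply: connect1; rewrite /avoid tlz li.
by apply: IH => //; apply: contra iNl; apply: connect_trans lz.
Qed.

(* The label of a vertex outside the separating bag is the component of the tree minus
   that bag in which the vertex lives. *)
Lemma balanced_separator : exists (j : I) (lab : T -> I),
  (forall u v, u \in U :\: bag j -> v \in U :\: bag j -> e u v -> lab u = lab v) /\
  forall l, ((#|[set v in U :\: bag j | lab v == l]|).*2 <= #|U|)%N.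
Proof.
have [j jP] := centroid_bag; exists j.
have [_ cov edg _] := dec.
have cov' v : exists i, v \in bag i by have [i] := cov v; exists i.
pose home v := xchoose (cov' v); 
have homeP v : v \in bag (home v) := xchooseP (cov' v).
exists (fun v => fingraph.root (avoid j) (home v)); split=> [u v|l].
  rewrite !inE => /andP[uj _] /andP[vj _] /edg[b /andP[ub vb]].
  apply/(fingraph.rootP (avoid_connect_sym j)).
  apply: (@connect_trans _ _ b); first exact: bag_connect uj (homeP u) ub.
  exact: bag_connect vj vb (homeP v).
set A := [set _ in _ | _].
have [->|[v]] := set_0Vmem A; first by rewrite cards0.
rewrite !inE => /andP[/andP[vj vU] /eqP vl].
have hj : home v != j by apply: contraNneq vj => <-.
apply: leq_trans (jP _ hj); rewrite leq_double; apply/subset_leq_card/subsetP => u.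
rewrite !inE => /andP[/andP[uj uU] /eqP ul]; rewrite uU uj /=.
apply/existsP; exists (home u); rewrite homeP /=.
by apply/(fingraph.rootP (avoid_connect_sym j)); rewrite vl ul.
Qed.

End BalancedSeparator.

(** * Poincare inequality for the interlace weight *)

Section InterlaceWeight.
Variables (R : realType) (T : finType) (e : rel T) (x y : R).
Hypotheses (hx : 1 < x) (hy : 1 < y).

Local Notation w := (interlace_weight e x y).
Local Notation rho := ((x - 1) / (y - 1)).
Local Notation theta := (Order.max rho rho^-1).

Let a_gt0 : 0 < x - 1. Proof. by rewrite subr_gt0. Qed.
Let b_gt0 : 0 < y - 1. Proof. by rewrite subr_gt0. Qed.
Let rho_gt0 : 0 < rho. Proof. exact: divr_gt0. Qed.

Lemma theta_ge1 : 1 <= theta.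
Proof.
rewrite le_max; have [//|r1] := leP 1 rho.
by rewrite invf_ge1// ltW.
Qed.

Lemma interlace_weight_gt0 S : 0 < w S.
Proof. by rewrite mulr_gt0// exprn_gt0. Qed.

(** This isolates the rank: the power of [y - 1] is a product over vertices, so only the power of
    [rho] is perturbed by deletions. *)
Lemma interlace_weightE S : w S = (y - 1) ^+ #|S| * rho ^+ rk2 e S.
Proof.
rewrite /interlace_weight expr_div_n mulrCA; congr (_ * _).
by rewrite expfB_cond// (gt_eqF b_gt0) rk2_le_card.
Qed.

Lemma interlace_weight_setU (A B : {set T}) : [disjoint A & B] ->
    (forall u v, u \in A -> v \in B -> ~~ e u v && ~~ e v u) ->
  w (A :|: B) = w A * w B.
Proof.
move=> dAB eAB; rewrite !interlace_weightE rk2_setU// cardsU.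
by rewrite (disjoint_setI0 dAB) cards0 subn0 !exprD mulrACA.
Qed.

(** The two weights differ by [rho ^+ d], where the drop [d] of the rank is at most 2. *)
Lemma interlace_weight_setD1 (S : {set T}) v :
  (w S <= theta ^+ 2 * ((y - 1) ^+ (v \in S) * w (S :\ v))) /\
  ((y - 1) ^+ (v \in S) * w (S :\ v) <= theta ^+ 2 * w S).
Proof.
have t0 : 0 < theta by apply: lt_le_trans theta_ge1.
have -> : (y - 1) ^+ (v \in S) * w (S :\ v) = (y - 1) ^+ #|S| * rho ^+ rk2 e (S :\ v).
  by rewrite interlace_weightE mulrA -exprD -cardsD1.
rewrite interlace_weightE.
have h1 := rk2_setD1 T e S v; have h2 := rk2_subset T e _ _ (subD1set S v).
move: (rk2 e S) (rk2 e (S :\ v)) h1 h2 => r r' h1 h2.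
have d2 : (r - r' <= 2)%N by rewrite leq_subLR.
rewrite -(subnKC h2) exprD; move: (r - r')%N d2 => d d2.
have td : theta ^+ d <= theta ^+ 2 by rewrite ler_weXn2l ?theta_ge1.
have c0 : 0 < (y - 1) ^+ #|S| by rewrite exprn_gt0.
have q0 : 0 < rho ^+ r' by rewrite exprn_gt0.
split; rewrite [leRHS]mulrCA ler_pM2l//.
  rewrite mulrC ler_pM2r//; apply: le_trans td.
  by rewrite lerXn2r ?nnegrE ?(ltW rho_gt0) ?(ltW t0)// le_max lexx.
rewrite mulrCA ler_pMr// -(@ler_pM2r _ (rho^-1 ^+ d)) ?exprn_gt0 ?invr_gt0//.
rewrite mul1r -mulrA -exprMn divff ?gt_eqF// expr1n mulr1; apply: le_trans td.
by rewrite lerXn2r ?nnegrE ?(ltW t0) ?invr_ge0 ?(ltW rho_gt0)// le_max lexx orbT.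
Qed.

(* Deleting [v] replaces [w] by a product of [w] on [U :\ v] and a weight on the single
   site [v]; this changes the weight by a factor of at most [theta ^+ 2]. *)
Lemma poincare_interlace_setD1 (U : {set T}) v K : 1 <= K ->
  poincare (U :\ v) w K -> poincare U w (theta ^+ 4 * K).
Proof.
move=> K1 pU; have K0 : 0 <= K by apply: le_trans K1.
have t1 := theta_ge1.
have [vU|vU] := boolP (v \in U); last first.
  apply: (poincare_le _ _ _ interlace_weight_gt0 _ (K := K)).
    by rewrite ler_peMl// exprn_ege1.
  by rewrite -[U in poincare U](_ : U :\ v = U)//; apply/setP => u; rewrite !inE;
    have [->|] := eqVneq u v; rewrite ?(negPf vU).
rewrite (exprM _ 2 2).
apply: (poincare_perturb _ _ _ _ (fun S => (y - 1) ^+ (v \in S) * w (S :\ v))) => //.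
- by rewrite exprn_ge0// (le_trans _ t1).
- by move=> S _; have [] := interlace_weight_setD1 S v.
- by move=> S _; have [] := interlace_weight_setD1 S v.
rewrite -[U](setD1K vU).
apply: (poincare_setU _ _ [set v]%SET (U :\ v) _ (fun S => (y - 1) ^+ (v \in S)) w) => //.
- by rewrite disjoints1 !inE eqxx.
- by move=> S; rewrite exprn_gt0.
- exact: interlace_weight_gt0.
- move=> S S' /subsetP Sv /subsetP S'U.
  have vS' : v \notin S' by apply/negP => /S'U; rewrite !inE eqxx.
  rewrite !inE (negPf vS') orbF; congr (_ * w _); apply/setP => u; rewrite !inE.
  have [->|uv] := eqVneq u v; first by rewrite (negPf vS').
  by case: (boolP (u \in S)) => // /Sv; rewrite inE (negPf uv).
apply: (poincare_le _ _ _ _ K1); first by move=> S; rewrite exprn_gt0.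
by apply: poincare_set1 => S; rewrite exprn_gt0.
Qed.

Lemma poincare_interlace_setD (U C : {set T}) K : 1 <= K ->
  poincare (U :\: C) w K -> poincare U w (theta ^+ (4 * #|C|) * K).
Proof.
move=> K1; have [n Cn] := ubnP #|C|; elim: n U C Cn => // n IH U C Cn pU.
have [C0|[v vC]] := set_0Vmem C.
  by move: pU; rewrite C0 cards0 muln0 expr0 mul1r setD0.
have CE : #|C| = #|C :\ v|.+1 by rewrite (cardsD1 v) vC.
rewrite CE mulnS exprD -mulrA; apply: (poincare_interlace_setD1 _ v).
  by rewrite mulr_ege1 ?exprn_ege1 ?theta_ge1.
apply: IH; first by rewrite -ltnS -CE.
have -> : (U :\ v) :\: (C :\ v) = U :\: C => //.
apply/setP => u; rewrite !inE; have [->|] := eqVneq u v; last by [].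
by rewrite vC andbF.
Qed.

(** No edge joins distinct labels, so the weight factorises over the label classes; they are added
    one at a time by tensorization. *)
Lemma poincare_interlace_labels (I : finType) (lab : T -> I) (W : {set T}) K : 1 <= K ->
    (forall u v, u \in W -> v \in W -> e u v -> lab u = lab v) ->
    (forall l, poincare [set v in W | lab v == l] w K) ->
  poincare W w K.
Proof.
move=> K1 labE labP.
have -> : W = [set v in W | lab v \in enum I].
  by apply/setP => u; rewrite !inE mem_enum andbT.
elim: (enum I) => [|l s IH].
  have -> : [set v in W | lab v \in [::]] = set0 by apply/setP => u; rewrite !inE andbF.
  exact: poincare_le _ _ _ _ interlace_weight_gt0 K1 (poincare_set0 _ _ _).
have [ls|ls] := boolP (l \in s).
  have -> // : [set v in W | lab v \in l :: s] = [set v in W | lab v \in s].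
  by apply/setP => u; rewrite !inE; case: eqP => [->|//]; rewrite ls.
set A := [set v in W | lab v == l]; set B := [set v in W | lab v \in s].
have -> : [set v in W | lab v \in l :: s] = A :|: B.
  by apply/setP => u; rewrite !inE andb_orr.
have dAB : [disjoint A & B].
  rewrite -setI_eq0; apply/eqP/setP => u; rewrite !inE.
  by case: eqP => [->|]; rewrite ?(negPf ls) !andbF.
apply: (poincare_setU _ _ A B w w w) => //; try exact: interlace_weight_gt0.
- exact: le_trans K1.
- move=> S S' SA S'B; apply: interlace_weight_setU.
    exact: disjointWl SA (disjointWr S'B dAB).
  move=> u v /(subsetP SA) + /(subsetP S'B); rewrite !inE => /andP[uW /eqP ul] /andP[vW vs].
  have uv : lab u != lab v by apply: contraNneq ls => E; rewrite -ul E.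
  by apply/andP; split; apply: contraNN uv => /labE -> //.
- exact: labP.
Qed.

(** Each level of the recursion removes a separator at cost [theta ^+ (4 * m)] and leaves parts of
    at most half the size, so [d] drops by one. *)
Lemma poincare_interlace_treewidth (I : finType) (t : rel I) (bag : I -> {set T}) (m : nat) :
    tree_decomposition e t bag -> (forall i, (#|bag i| <= m)%N) ->
  forall d (U : {set T}), (#|U| < 2 ^ d)%N -> poincare U w (theta ^+ (4 * m * d)).
Proof.
move=> dec bagm; have t1 := theta_ge1; elim=> [|d IH] U Ud.
  rewrite muln0 expr0 (_ : U = set0); first exact: poincare_set0.
  by apply/eqP; rewrite -cards_eq0 -leqn0 -ltnS.
have [tree_t _ _ _] := dec.
have [j [lab [labE labU]]] := balanced_separator I t tree_t T e bag dec U.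
have K1 : 1 <= theta ^+ (4 * m * d) by rewrite exprn_ege1.
apply: (poincare_le _ _ _ interlace_weight_gt0 _
   (K := theta ^+ (4 * #|bag j|) * theta ^+ (4 * m * d))).
  by rewrite -exprD mulnS ler_weXn2l // leq_add2r leq_mul2l bagm orbT.
apply: poincare_interlace_setD => //.
apply: (poincare_interlace_labels _ lab) => // l; apply: IH.
rewrite -ltn_double -[X in (_ < X)%N]mul2n -expnS.
exact: leq_ltn_trans (labU l) Ud.
Qed.

End InterlaceWeight.

(** * Mixing of lazy reversible chains *)

Section ReversibleChain.
Variables (R : realType) (A : finType) (P : A -> A -> R) (w : A -> R).
Hypothesis w_gt0 : forall a, 0 < w a.
Hypothesis P_ge0 : forall a b, 0 <= P a b.
Hypothesis P_sum1 : forall a, \sum_b P a b = 1.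
Hypothesis P_lazy : forall a, 2^-1 <= P a a.
Hypothesis P_rev : forall a b, w a * P a b = w b * P b a.

Local Notation Z := (\sum_a w a).

Definition chain_op (f : A -> R) (a : A) : R := \sum_b P a b * f b.

Definition sqnorm (f : A -> R) : R := \sum_a w a * f a ^+ 2.

Lemma sum_reversible (f : A -> R) : \sum_a \sum_b w a * P a b * f b = \sum_a w a * f a.
Proof.
rewrite exchange_big /=; apply: eq_bigr => b _; rewrite -mulr_suml.
by under eq_bigr do rewrite P_rev; rewrite -mulr_sumr P_sum1 mulr1.
Qed.

Lemma chain_op_mean f : \sum_a w a * chain_op f a = \sum_a w a * f a.
Proof.
rewrite -[RHS]sum_reversible; apply: eq_bigr => a _; rewrite /chain_op mulr_sumr.
by apply: eq_bigr => b _; rewrite mulrA.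
Qed.

(** Expand the square: both pure terms sum to [sqnorm f], one by the row sums of [P] and the other
    by reversibility. *)
Lemma chain_op_dirichlet f :
  \sum_a w a * (f a * chain_op f a) =
  sqnorm f - 2^-1 * \sum_a \sum_b w a * P a b * (f b - f a) ^+ 2.
Proof.
have -> : \sum_a \sum_b w a * P a b * (f b - f a) ^+ 2 =
    \sum_a \sum_b w a * P a b * f b ^+ 2 + sqnorm f
      - 2 * \sum_a w a * (f a * chain_op f a).
  rewrite mulr_sumr -big_split -sumrB /=; apply: eq_bigr => a _.
  have -> : w a * f a ^+ 2 = \sum_b w a * P a b * f a ^+ 2.
    by rewrite -mulr_suml -mulr_sumr P_sum1 mulr1.
  rewrite /chain_op !mulr_sumr -big_split -sumrB /=; apply: eq_bigr => b _; ring.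
by rewrite (sum_reversible (fun b => f b ^+ 2)) -/(sqnorm f); field.
Qed.

(* Laziness makes [P = (1 + Q) / 2] for a reversible stochastic [Q], so [P] is positive and
   [P ^ 2 <= P]. *)
Lemma sqnorm_chain_op f :
  sqnorm (chain_op f) <= \sum_a w a * (f a * chain_op f a).
Proof.
pose Q a b := 2 * P a b - (b == a)%:R.
have Q0 a b : 0 <= Q a b.
  rewrite /Q; have := P_ge0 a b; have [->|_] := eqVneq b a; last by rewrite subr0; lra.
  by have := P_lazy a; rewrite /=; lra.
have sum_eq a (g : A -> R) : \sum_b (b == a)%:R * g b = g a.
  by rewrite (bigD1 a)//= eqxx mul1r big1 ?addr0// => b /negPf ->; rewrite mul0r.
have Q1 a : \sum_b Q a b = 1.
  rewrite sumrB -mulr_sumr P_sum1 (_ : \sum_b _ = 1); first by ring.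
  by rewrite -[RHS](sum_eq a (fun=> 1)); apply: eq_bigr => b _; rewrite mulr1.
have QE a : \sum_b Q a b * f b = 2 * chain_op f a - f a.
  rewrite -[X in _ - X](sum_eq a f) /chain_op mulr_sumr -sumrB.
  by apply: eq_bigr => b _; rewrite /Q mulrBl mulrA.
have jensen a : (2 * chain_op f a - f a) ^+ 2 <= \sum_b Q a b * f b ^+ 2.
  have := @jensen_sqr R A predT (Q a) f (Q0 a).
  by rewrite Q1 ltr01 QE mul1r divr1; apply.
(* [Q] contracts the norm by Jensen and reversibility; expanding this square gives the claim. *)
have : \sum_a w a * (2 * chain_op f a - f a) ^+ 2 <= sqnorm f.
  apply: (@le_trans _ _ (\sum_a w a * \sum_b Q a b * f b ^+ 2)).
    by apply: ler_sum => a _; rewrite ler_wpM2l// ltW.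
  rewrite le_eqVlt; apply/orP; left; apply/eqP.
  transitivity (2 * \sum_a \sum_b w a * P a b * f b ^+ 2 - sqnorm f).
    rewrite mulr_sumr -sumrB; apply: eq_bigr => a _.
    rewrite -[f a ^+ 2](sum_eq a (fun b => f b ^+ 2)) !mulr_sumr -sumrB.
    by apply: eq_bigr => b _; rewrite /Q; ring.
  by rewrite (sum_reversible (fun b => f b ^+ 2)) -/(sqnorm f); ring.
have -> : \sum_a w a * (2 * chain_op f a - f a) ^+ 2 =
    4 * sqnorm (chain_op f) - 4 * (\sum_a w a * (f a * chain_op f a)) + sqnorm f.
  by rewrite !mulr_sumr -sumrB -big_split /=; apply: eq_bigr => a _; ring.
lra.
Qed.

Variable g : R.
Hypothesis g_le1 : g <= 1.
Hypothesis gap : forall f, \sum_a w a * f a = 0 ->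
  g * sqnorm f <= 2^-1 * \sum_a \sum_b w a * P a b * (f b - f a) ^+ 2.

(** One step loses at least the Dirichlet form, which the gap bounds below by [g * sqnorm f]; the
    mean stays zero, so the step can be repeated. *)
Lemma sqnorm_iter f t : \sum_a w a * f a = 0 ->
  sqnorm (iter t chain_op f) <= (1 - g) ^+ t * sqnorm f /\
  \sum_a w a * iter t chain_op f a = 0.
Proof.
move=> f0; elim: t => [|t [IH m0]] /=; first by rewrite expr0 mul1r.
split; last by rewrite chain_op_mean.
apply: le_trans (sqnorm_chain_op _) _; rewrite chain_op_dirichlet.
have := gap _ m0 => h.
apply: (@le_trans _ _ ((1 - g) * sqnorm (iter t chain_op f))); first by lra.
by rewrite exprS -mulrA ler_wpM2l// subr_ge0.
Qed.

Lemma tstep0 (a b : A) : tstep P 0 a b = (a == b)%:R.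
Proof. by rewrite /tstep expr0 mxE (inj_eq enum_rank_inj). Qed.

Lemma tstepS t (a b : A) : tstep P t.+1 a b = \sum_c tstep P t a c * P c b.
Proof.
rewrite /tstep exprSr mxE (reindex _ (onW_bij _ (@enum_rank_bij A))) /=.
by apply: eq_bigr => c _; rewrite [transition_matrix P _ _]mxE !enum_rankK.
Qed.

(** By reversibility, densities relative to [w] evolve under the same operator as functions. *)
Lemma tstep_density a t b :
  tstep P t a b / w b = iter t chain_op (fun b => (a == b)%:R / w a) b.
Proof.
elim: t b => [|t IH] b /=.
  by rewrite tstep0; have [->|] := eqVneq a b; rewrite ?mul0r.
rewrite tstepS mulr_suml; apply: eq_bigr => c _; rewrite -IH.
have -> : P b c = w c * P c b / w b by rewrite P_rev mulrAC divff ?gt_eqF// mul1r.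
by field; rewrite !gt_eqF.
Qed.

Lemma total_weight_gt0 (a : A) : 0 < Z.
Proof. by rewrite (bigD1 a)//= ltr_pwDl// sumr_ge0// => b _; apply: ltW. Qed.

Lemma iter_chain_opB t f h b :
  iter t chain_op (fun b => f b - h b) b = iter t chain_op f b - iter t chain_op h b.
Proof.
elim: t b => //= t IH b; rewrite /chain_op -sumrB; apply: eq_bigr => c _.
by rewrite IH mulrBr.
Qed.

Lemma iter_chain_op_cst t c b : iter t chain_op (fun=> c) b = c.
Proof.
elim: t b => //= t IH b; rewrite /chain_op; under eq_bigr do rewrite IH.
by rewrite -mulr_suml P_sum1 mul1r.
Qed.

Lemma tv_dist_sqr_le a t :
  (2 * tv_dist (tstep P t a) (fun b => w b / Z)) ^+ 2 <= (1 - g) ^+ t * (Z / w a).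
Proof.
have Z0 := total_weight_gt0 a.
(* The density of the point mass at [a] minus that of the stationary law, both relative to [w]. The
   total variation distance is half its weighted [L^1] norm after [t] steps, which Jensen compares
   with [sqnorm]. *)
pose f b := (a == b)%:R / w a - Z^-1.
have E b : tstep P t a b - w b / Z = w b * iter t chain_op f b.
  rewrite iter_chain_opB iter_chain_op_cst -tstep_density.
  by rewrite mulrBr [w b * (_ / _)]mulrC divfK ?gt_eqF.
have f0 : \sum_b w b * f b = 0.
  rewrite /f; under eq_bigr do rewrite mulrBr; rewrite sumrB -mulr_suml divff ?gt_eqF//.
  rewrite (bigD1 a)//= eqxx mul1r divff ?gt_eqF// big1 ?addr0 ?subrr// => b /negPf ba.
  by rewrite eq_sym ba mul0r mulr0.
have nf : sqnorm f <= (w a)^-1.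
  have -> : sqnorm f = (w a)^-1 - Z^-1.
    have -> : sqnorm f = \sum_b w b * ((a == b)%:R / w a) ^+ 2
        - 2 * Z^-1 * (\sum_b w b * f b) - Z * Z^-1 ^+ 2.
      rewrite /sqnorm mulr_sumr mulr_suml -!sumrB; apply: eq_bigr => b _.
      by rewrite /f; ring.
    rewrite f0 mulr0 subr0 [X in X - _](bigD1 a)//= eqxx [X in _ + X - _]big1 => [|b /negPf ba]; last first.
      by rewrite eq_sym ba mul0r expr0n mulr0.
    rewrite mul1r addr0; move: (\sum_a w a) Z0 (w a) (w_gt0 a) => z z0 u u0.
    by field; rewrite !gt_eqF.
  by rewrite lerBlDr lerDl invr_ge0 ltW.
have [nt _] := sqnorm_iter _ t f0.
have -> : 2 * tv_dist (tstep P t a) (fun b => w b / Z) = \sum_b w b * `|iter t chain_op f b|.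
  rewrite /tv_dist mulrA divff// mul1r; apply: eq_bigr => b _.
  by rewrite E normrM gtr0_norm.
have := @jensen_sqr R A predT w (fun b => `|iter t chain_op f b|) (fun b => ltW (w_gt0 b)) Z0.
under [X in _ <= X -> _]eq_bigr do rewrite real_normK ?num_real//.
rewrite -/(sqnorm (iter t chain_op f)) => h.
have {}h : (\sum_b w b * `|iter t chain_op f b|) ^+ 2 <= Z * sqnorm (iter t chain_op f).
  rewrite [leRHS]mulrC -ler_pdivrMr//; apply: le_trans h.
  move: (\sum_b w b * _) (\sum_a w a) Z0 => u z z0.
  by rewrite le_eqVlt; apply/orP; left; apply/eqP; field; rewrite gt_eqF.
apply: le_trans h _; rewrite mulrCA ler_wpM2l ?(ltW Z0)//.
apply: le_trans nt _; rewrite ler_wpM2l// exprn_ge0// subr_ge0//.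
Qed.

End ReversibleChain.

Arguments sqnorm {R A}.

(** * Spectral gap and convergence of the flip chain *)

Section FlipChainGap.
Variables (R : realType) (T : finType) (w : {set T} -> R).
Hypothesis w_gt0 : forall S, 0 < w S.
Hypothesis T_gt0 : (0 < #|T|)%N.

Let n_gt0 : 0 < #|T|%:R :> R. Proof. by rewrite ltr0n. Qed.

Lemma flip_chain_lazy (X : {set T}) : 2^-1 <= flip_chain w X X.
Proof.
have -> : 2^-1 = \sum_(v : T) #|T|%:R^-1 * 2^-1 :> R.
  by rewrite sumr_const -mulrnAl -[X in X * _]mulr_natr mulVf ?mul1r ?gt_eqF.
apply: ler_sum => v _; rewrite ler_wpM2l ?invr_ge0 ?(ltW n_gt0)//= eqxx mulr1.
have := flip_accept_gt0 w_gt0 X (symdiff X [set v]%SET).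
have : flip_accept w X (symdiff X [set v]%SET) <= 2^-1.
  by rewrite /flip_accept ger_pMr ?invr_gt0// ge_min lexx.
by case: eqP => _ /=; lra.
Qed.

(** The factor 4 combines the 1/2 of the quadratic form with the 1/2 in the acceptance probability;
    [#|T|] comes from the choice of the site. *)
Lemma flip_chain_dirichlet (f : {set T} -> R) :
  2^-1 * \sum_X \sum_Y w X * flip_chain w X Y * (f Y - f X) ^+ 2 =
  (4 * #|T|%:R)^-1 * dirichlet setT w f.
Proof.
rewrite /dirichlet [in RHS](eq_bigl predT) => [|S]; last by rewrite finset.subsetT.
rewrite !mulr_sumr; apply: eq_bigr => X _.
transitivity (2^-1 * (w X * \sum_v #|T|%:R^-1 *
    (flip_accept w X (symdiff X [set v]%SET) * (f (symdiff X [set v]%SET) - f X) ^+ 2))).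
  congr (_ * _); rewrite mulr_sumr; under eq_bigr do rewrite -mulrA.
  rewrite -[LHS]mulr_sumr -[RHS]mulr_sumr; congr (_ * _).
  rewrite /flip_chain; under eq_bigr do rewrite mulr_suml.
  rewrite exchange_big /=; apply: eq_bigr => v _; set S := symdiff X _.
  under eq_bigr do rewrite -mulrA; rewrite -mulr_sumr; congr (_ * _).
  rewrite (bigD1 S)//= eqxx big1 ?addr0 => [|Y /negPf YS].
    case: eqP => [->|_]; first by rewrite subrr expr0n !mulr0.
    by rewrite mulr0 addr0 mulr1.
  rewrite YS mulr0 add0r; case: eqP => [->|_]; last by rewrite mulr0 mul0r.
  by rewrite subrr expr0n mulr0.
rewrite !mulr_sumr; apply: eq_big => [v|v _]; first by rewrite in_setT.
rewrite /flip_accept; set S := symdiff X _.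
have -> : Order.min (w X) (w S) = w X * Order.min 1 (w S / w X).
  by rewrite minr_pMr ?(ltW (w_gt0 _))// mulr1 mulrC divfK ?gt_eqF.
by move: (Order.min _ _) => r; field; rewrite gt_eqF.
Qed.

Lemma flip_chain_gap K (f : {set T} -> R) : 0 < K -> poincare setT w K ->
    \sum_X w X * f X = 0 ->
  (4 * #|T|%:R * K)^-1 * sqnorm w f <=
  2^-1 * \sum_X \sum_Y w X * flip_chain w X Y * (f Y - f X) ^+ 2.
Proof.
move=> K0 pT f0; rewrite flip_chain_dirichlet invfM -mulrA.
rewrite ler_wpM2l ?invr_ge0 ?mulr_ge0 ?(ltW n_gt0)//.
rewrite mulrC ler_pdivrMr// mulrC.
have [c cP] := pT f; apply: le_trans cP.
rewrite [leRHS](eq_bigl predT) => [|S]; last by rewrite finset.subsetT.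
rewrite sum_sqr_mean ?gt_eqF//; last by rewrite partition_gt0.
rewrite f0 mul0r.
have -> : sqnorm w f = \sum_S w S * (f S - 0) ^+ 2.
  by apply: eq_bigr => S _; rewrite subr0.
by rewrite lerDl mulr_ge0 ?sqr_ge0// ltW// partition_gt0.
Qed.

(** The general bound with [g = (4 * #|T| * K)^-1], followed by [1 - g <= expR (- g)]. *)
Lemma flip_chain_tv_dist_le K X t : 1 <= K -> poincare setT w K ->
  (2 * tv_dist (tstep (flip_chain w) t X) (gibbs w)) ^+ 2 <=
  expR (- ((4 * #|T|%:R * K)^-1 * t%:R)) * ((\sum_S w S) / w X).
Proof.
move=> K1 pT; have K0 : 0 < K by apply: lt_le_trans K1.
have n1 : 1 <= #|T|%:R :> R by rewrite ler1n.
have g1 : (4 * #|T|%:R * K)^-1 <= 1 by rewrite invf_le1; nra.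
apply: le_trans (tv_dist_sqr_le _ _ _ _ w_gt0 (flip_chain_ge0 w_gt0)
  (flip_chain_sum1 w T_gt0) flip_chain_lazy (flip_balance w_gt0) _ g1
  (fun f => flip_chain_gap K f K0 pT) X t) _.
rewrite ler_wpM2r ?divr_ge0 ?(ltW (w_gt0 _)) ?(ltW (partition_gt0 _))//.
rewrite -mulNr expRM_natr.
rewrite lerXn2r ?nnegrE ?expR_ge0 ?subr_ge0//.
exact: expR_ge1Dx.
Qed.

End FlipChainGap.

(** * From convergence to the mixing time bound *)

Lemma mixing_time_le (R : realType) (A : finType) (P : A -> A -> R) (pi : A -> R) (eps B : R) :
  (forall a, exists2 t, tv_dist (tstep P t a) pi <= eps & t%:R <= B) ->
  (mixing_time P pi eps <= B%:E)%E.
Proof.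
move=> tP; apply/bigmax_leP; split; first exact: leNye.
move=> a _; have [t tv tB] := tP a.
apply: (@le_trans _ _ (t%:R%:E)); last by rewrite lee_fin.
by apply: ereal_inf_lbound; exists t.
Qed.

Lemma treewidth_decomposition (T : finType) (e : rel T) : exists (I : finType) (t : rel I)
    (bag : I -> {set T}), tree_decomposition e t bag /\
  forall i, (#|bag i| <= (treewidth e).+1)%N.
Proof.
rewrite /treewidth; case: ex_minnP => k /asboolP[I [t [bag [dec <-]]]] _.
exists I, t, bag; split=> // i; apply: leq_trans (leqSpred _).
exact: (leq_bigmax i).
Qed.

Lemma interlace_weight_bounds (R : realType) (T : finType) (e : rel T) (x y M : R)
    (S : {set T}) : 1 <= M -> 0 < x - 1 -> 0 < y - 1 ->
    x - 1 <= M -> y - 1 <= M -> (x - 1)^-1 <= M -> (y - 1)^-1 <= M ->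
  interlace_weight e x y S <= M ^+ #|T| /\ 1 <= M ^+ #|T| * interlace_weight e x y S.
Proof.
rewrite /interlace_weight => M1; move: (x - 1) (y - 1) => a b a0 b0 aM bM aM' bM'.
have M0 : 0 < M by apply: lt_le_trans M1.
have := rk2_le_card T e S; have := max_card (mem S).
move: (rk2 e S) #|S| => r s sn rs.
have {}rs : s = (r + (s - r))%N by rewrite subnKC.
move: (s - r)%N rs => d rs; rewrite {s}rs in sn.
have Mn : M ^+ r * M ^+ d <= M ^+ #|T| by rewrite -exprD ler_weXn2l.
split.
  apply: le_trans Mn; apply: ler_pM; rewrite ?exprn_ge0 ?(ltW a0) ?(ltW b0)//.
    by rewrite lerXn2r ?nnegrE ?(ltW a0) ?(ltW M0).
  by rewrite lerXn2r ?nnegrE ?(ltW b0) ?(ltW M0).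
apply: (@le_trans _ _ (M ^+ r * M ^+ d * (a ^+ r * b ^+ d))); last first.
  by rewrite ler_wpM2r// ltW// mulr_gt0// exprn_gt0.
rewrite mulrACA -!exprMn; apply: mulr_ege1; apply: exprn_ege1.
  by rewrite -ler_pdivrMr// div1r.
by rewrite -ler_pdivrMr// div1r.
Qed.

Lemma ln_max_inv (R : realType) (r : R) : 0 < r -> ln (Order.max r r^-1) = `|ln r|.
Proof.
move=> r0; have [r1|r1] := leP 1 r.
  rewrite max_l ?ger0_norm ?ln_ge0//.
  by apply: (le_trans _ r1); rewrite invf_le1.
rewrite max_r; last by apply: (le_trans (ltW r1)); rewrite invf_ge1// ltW.
by rewrite lnV ?posrE// ler0_norm// ln_le0// ltW.
Qed.

(** Turns the logarithmic recursion depth into a power of [n]; the successor in the exponent costs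
    the constant [theta ^+ m]. *)
Lemma expr_trunc_log_le (R : realType) (theta : R) (m n : nat) : 1 <= theta -> (0 < n)%N ->
  theta ^+ (m * (trunc_log 2 n).+1) <= theta ^+ m * n%:R `^ (m%:R * (ln theta / ln 2)).
Proof.
move=> t1 n0; have t0 : 0 < theta by apply: lt_le_trans t1.
have l2 : 0 < ln 2 :> R by rewrite ln_gt0// ltr1n.
rewrite mulnS exprD ler_wpM2l ?exprn_ge0 ?(ltW t0)//.
rewrite -[X in X ^+ _](lnK (x := theta)) ?posrE// -expRM_natl /powR pnatr_eq0 gtn_eqF//.
rewrite ler_expR natrM -!mulrA ler_wpM2l// [leLHS]mulrC.
rewrite ler_wpM2l ?ln_ge0// [leRHS]mulrC ler_pdivlMr//.
rewrite mulr_natl -lnXn// ler_ln ?posrE ?exprn_gt0 ?ltr0n//.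
by rewrite -natrX ler_nat trunc_logP.
Qed.

(** Without vertices the sum defining [flip_chain] is empty and its rows do not sum to 1, so this
    case is settled at time 0. *)
Lemma mixing_time_empty (R : realType) (T : finType) (w : {set T} -> R) (eps : R) :
  (forall S, 0 < w S) -> #|T| = 0%N -> 0 < eps ->
  (mixing_time (flip_chain w) (gibbs w) eps <= 0%:E)%E.
Proof.
move=> w0 T0 eps0; apply: mixing_time_le => X; exists 0%N => //.
have all0 (S : {set T}) : S = set0.
  by apply/eqP; rewrite -cards_eq0 -leqn0 -T0 max_card.
have sumE (F : {set T} -> R) : \sum_S F S = F set0.
  by rewrite (bigD1 set0)//= big1 ?addr0// => S; rewrite (all0 S) eqxx.
rewrite /tv_dist sumE tstep0 /gibbs sumE (all0 X) eqxx divff ?gt_eqF//.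
by rewrite subrr normr0 mulr0 ltW.
Qed.

Theorem corollary10 (R : realType) (x y : R) (hx : 1 < x) (hy : 1 < y) (k : nat) :
  exists C : R,
    forall (T : finType) (e : rel T), symmetric e -> irreflexive e -> treewidth e = k ->
    forall eps : R, 0 < eps -> eps <= 2^-1 ->
      (mixing_time (flip_chain (interlace_weight e x y)) (gibbs (interlace_weight e x y)) eps
       <= (C * #|T|%:R `^ (2 + 8 * (k + 1)%:R * `|ln ((x - 1) / (y - 1)) / ln 2|)
             * ln (1 / eps))%:E)%E.
Proof.
have a0 : 0 < x - 1 by rewrite subr_gt0.
have b0 : 0 < y - 1 by rewrite subr_gt0.
pose M := 1 + (x - 1) + (y - 1) + (x - 1)^-1 + (y - 1)^-1.
have a0' : 0 < (x - 1)^-1 by rewrite invr_gt0.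
have b0' : 0 < (y - 1)^-1 by rewrite invr_gt0.
have [M1 aM bM aM' bM'] : [/\ 1 <= M, x - 1 <= M, y - 1 <= M, (x - 1)^-1 <= M
    & (y - 1)^-1 <= M] by rewrite /M; split; lra.
have M0 : 0 < M by apply: lt_le_trans M1.
(* [D ^+ n] bounds [Z / w X]: there are [2 ^ n] subsets, and [M ^+ n] bounds each weight and each
   inverse weight. *)
pose D := 2 * M ^+ 2.
have D1 : 1 <= D by rewrite /D; nra.
have D0 : 0 < D by apply: lt_le_trans D1.
set rho := (x - 1) / (y - 1); pose theta := Order.max rho rho^-1.
have t1 : 1 <= theta by apply: theta_ge1.
have l2 : 0 < ln 2 :> R by rewrite ln_gt0// ltr1n.
have lD : 0 <= ln D by rewrite ln_ge0.
(* The three summands absorb the two terms of [s] and the 1 of [s + 1] below; those free of [eps]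
   are divided by [ln 2], because [ln 2 <= L]. *)
exists ((4 * (ln D / ln 2) + 8 + (ln 2)^-1) * theta ^+ (4 * k.+1)).
move=> T e _ _ tw eps eps0 epsh.
set w := interlace_weight e x y.
have w0 S : 0 < w S by apply: interlace_weight_gt0.
set p := 2 + _.
have p2 : 2 <= p by rewrite /p lerDl !mulr_ge0.
have [T0|T0] := posnP #|T|.
  rewrite T0 powR0; last by rewrite gt_eqF//; apply: lt_le_trans p2.
  by rewrite mulr0 mul0r; apply: mixing_time_empty.
set n : R := #|T|%:R; have n1 : 1 <= n by rewrite ler1n.
have n0 : 0 < n by apply: lt_le_trans n1.
pose L := ln (1 / eps); rewrite -/L.
have lL : ln 2 <= L.
  by rewrite /L ler_ln ?posrE ?divr_gt0// ler_pdivlMr//; lra.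
have L0 : 0 <= L by apply: le_trans (ltW l2) lL.
pose K := theta ^+ (4 * k.+1 * (trunc_log 2 #|T|).+1).
have K1 : 1 <= K by rewrite exprn_ege1.
have pT : poincare setT w K.
  have [I [t [bag [dec bagk]]]] := treewidth_decomposition T e; rewrite tw in bagk.
  apply: (poincare_interlace_treewidth _ _ _ _ _ hx hy _ _ _ _ dec bagk).
  by rewrite cardsT trunc_log_ltn.
have ZD X : (\sum_S w S) / w X <= D ^+ #|T|.
  have b S := interlace_weight_bounds R T e x y M S M1 a0 b0 aM bM aM' bM'.
  rewrite ler_pdivrMr//.
  apply: (@le_trans _ _ (\sum_(S : {set T}) M ^+ #|T|)).
    by apply: ler_sum => S _; have [] := b S.
  have card_set : #|{set T}| = (2 ^ #|T|)%N.
    by rewrite -[LHS]cardsT -powersetT card_powerset cardsT.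
  rewrite sumr_const card_set -mulr_natl natrX.
  rewrite /D exprMn -mulrA ler_wpM2l ?exprn_ge0// exprAC expr2 -mulrA.
  by rewrite ler_peMr ?exprn_ge0 ?(ltW M0)//; have [] := b X.
set B := _ * L.
(* At time [s] the exponential factor equals [eps ^+ 2 / D ^+ n]; [2 * L] appears because the
   distance is squared. *)
pose s := 4 * n * K * (n * ln D + 2 * L).
have s0 : 0 <= s.
  by rewrite /s !mulr_ge0 ?addr_ge0 ?mulr_ge0//; apply: ltW; lra.
have sB : s + 1 <= B.
  (* The recursion yields the exponent with 4 in place of 8, so [p - 2] is large enough. *)
  have KB : K <= theta ^+ (4 * k.+1) * n `^ (p - 2).
    apply: le_trans (expr_trunc_log_le _ _ _ _ t1 T0) _.
    rewrite ler_wpM2l ?exprn_ge0 ?(le_trans _ t1)//.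
    rewrite ler_powR// /p addrAC subrr add0r ln_max_inv ?divr_gt0//.
    rewrite normrM normfV (ger0_norm (ltW l2)) -/rho ler_wpM2r ?divr_ge0 ?(ltW l2)//.
    by rewrite natrM addn1 ler_wpM2r// ler_nat.
  have -> : B = (4 * (ln D / ln 2) + 8 + (ln 2)^-1) * (theta ^+ (4 * k.+1) * n `^ (p - 2))
       * n ^+ 2 * L.
    rewrite /B -/n -{1}(subrK 2 p) powRD; last by rewrite (gt_eqF n0) implybT.
    by rewrite powR_mulrn ?(ltW n0)// !mulrA.
  apply: (@le_trans _ _ ((4 * (ln D / ln 2) + 8 + (ln 2)^-1) * K * n ^+ 2 * L)); last first.
    rewrite ler_wpM2r// ler_wpM2r ?sqr_ge0// ler_wpM2l//.
    by rewrite !addr_ge0 ?mulr_ge0 ?divr_ge0 ?invr_ge0 ?(ltW l2).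
  pose u := L / ln 2.
  have u1 : 1 <= u by rewrite /u ler_pdivlMr// mul1r.
  have -> : (4 * (ln D / ln 2) + 8 + (ln 2)^-1) * K * n ^+ 2 * L =
     4 * n ^+ 2 * K * (ln D * u) + 8 * n ^+ 2 * K * L + n ^+ 2 * K * u.
    by rewrite /u; field; rewrite gt_eqF.
  have n21 : 1 <= n ^+ 2 by rewrite exprn_ege1.
  have K0 : 0 <= K by apply: le_trans K1.
  have -> : s = 4 * n ^+ 2 * K * ln D + 8 * n * K * L by rewrite /s; ring.
  apply: lerD; first apply: lerD.
  - by rewrite ler_wpM2l ?ler_peMr// !mulr_ge0// ltW.
  - rewrite ler_wpM2r ?(le_trans (ltW l2))// ler_wpM2r// ler_wpM2l// expr2.
    by rewrite ler_peMr// ltW.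
  - by apply: mulr_ege1 => //; apply: mulr_ege1.
(* Rounding [s] up to an integer time costs at most 1, hence the bound on [s + 1]. *)
apply: mixing_time_le => X; exists (Num.truncn s).+1; last first.
  apply: le_trans sB; rewrite -natr1 lerD2r.
  by have /andP[] := truncn_itv s0.
set t := _.+1; have st : s <= t%:R by have /andP[_ /ltW] := truncn_itv s0.
have := flip_chain_tv_dist_le R T w w0 T0 K X t K1 pT.
set tv := tv_dist _ _ => tvle.
have tv0 : 0 <= tv by rewrite mulr_ge0 ?invr_ge0// sumr_ge0.
have {}tvle : (2 * tv) ^+ 2 <= eps ^+ 2.
  apply: le_trans tvle _.
  apply: (@le_trans _ _ (expR (- (n * ln D + 2 * L)) * D ^+ #|T|)).
    apply: ler_pM; rewrite ?expR_ge0 ?(ltW (divr_gt0 (partition_gt0 w0) (w0 X)))//.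
    rewrite ler_expR lerN2 [leRHS]mulrC ler_pdivlMr ?mulr_gt0 ?(lt_le_trans _ K1)//.
    by rewrite [leLHS]mulrC.
  rewrite -[D in D ^+ _]lnK ?posrE// -expRM_natl -expRD -/n.
  have -> : - (n * ln D + 2 * L) + n * ln D = 2 * ln eps.
    by rewrite /L div1r lnV ?posrE//; ring.
  by rewrite expRM_natl lnK ?posrE.
have tv20 : 0 <= 2 * tv by apply: mulr_ge0.
rewrite ler_sqr ?nnegrE// ?(ltW eps0)// in tvle.
by lra.
Qed.
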